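(* Let $\mathcal{M}$ be a finite unitary magma and $m:=\#\mathcal{M}$. For all $n\ge2$, $$\dim\mathsf{NC}\mathcal{M}(n)=\sum_{0\le k\le n-2}m^{n+k+1}(m-1)^{n-k-2}\,\mathrm{nar}(n,k),$$ where $\mathrm{nar}(n,k):=\frac{1}{k+1}\binom{n-2}{k}\binom{n-1}{k}$.
   Context: A unitary magma is a set $\mathcal{M}$ with a binary operation $\star$ (not necessarily associative) having a two-sided unit $\mathds{1}_{\mathcal{M}}$. An $\mathcal{M}$-clique $\mathfrak{p}$ of arity $n\ge1$ is a map assigning to every arc $(x,y)$, $1\le x<y\le n+1$, a label $\mathfrak{p}(x,y)\in\mathcal{M}$; by convention, the only $\mathcal{M}$-clique of arity $1$ is the one with $\mathfrak{p}(1,2)=\mathds{1}_{\mathcal{M}}$. A diagonal is an arc different from $(1,n+1)$ and from all $(x,x+1)$; an arc is solid if its label is not $\mathds{1}_{\mathcal{M}}$. Two diagonals $(x,y)$, $(x',y')$ are crossing if $x<x'<y<y'$ or $x'<x<y'<y$. An $\mathcal{M}$-clique is noncrossing if no two of its solid diagonals are crossing. $\mathsf{NC}\mathcal{M}$ (the noncrossing $\mathcal{M}$-clique operad) has as space $\mathsf{NC}\mathcal{M}(n)$ the linear span, over a field $\mathbb{K}$ of characteristic zero, of all noncrossing $\mathcal{M}$-cliques of arity $n$ (its operad structure is not needed for this statement). The convention $0^0=1$ is used. *)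

(* Defs.v *)
From HB Require Import structures.
From mathcomp Require Import all_boot all_order all_algebra.

Set Implicit Arguments.
Unset Strict Implicit.
Unset Printing Implicit Defensive.

Import GRing.Theory Num.Theory.

#[short(type="finUMagmaType")]
HB.structure Definition FinUMagma := {M of UMagma M & Finite M}.

(* The vertices 1, ..., n+1 are encoded by the ordinals 0, ..., n. *)
Definition arc (n : nat) : Type := {a : 'I_n.+1 * 'I_n.+1 | a.1 < a.2}.

Definition src (n : nat) (a : arc n) : nat := (val a).1.
Definition tgt (n : nat) (a : arc n) : nat := (val a).2.

Definition diagonal (n : nat) (a : arc n) : bool :=
  ~~ ((src a == 0) && (tgt a == n)) && (tgt a != (src a).+1).

Definition crossing (n : nat) (a b : arc n) : bool :=
  [&& src a < src b, src b < tgt a & tgt a < tgt b]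
  || [&& src b < src a, src a < tgt b & tgt b < tgt a].

(* The side condition is void except in arity 1, where by convention the only
   clique is the one labelled by the unit. *)
Definition clique (M : finUMagmaType) (n : nat) : Type :=
  {p : {ffun arc n -> M} | (n == 1) ==> [forall a, p a == 1%g]}.

Definition solid (M : finUMagmaType) (n : nat) (p : clique M n) (a : arc n) :
  bool := val p a != 1%g.

Definition noncrossing (M : finUMagmaType) (n : nat) (p : clique M n) : bool :=
  [forall a : arc n, forall b : arc n,
    [&& diagonal a, diagonal b, solid p a & solid p b] ==> ~~ crossing a b].

Local Open Scope ring_scope.

(* The free K-vector space on the M-cliques of arity n; K^o is K regarded as a
   vector space over itself. *)
Definition clique_space (K : fieldType) (M : finUMagmaType) (n : nat) :
  vectType K := {ffun clique M n -> K^o}.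

Definition clique_vect (K : fieldType) (M : finUMagmaType) (n : nat)
    (p : clique M n) : clique_space K M n :=
  [ffun q : clique M n => (q == p)%:R : K^o].

Definition NC (K : fieldType) (M : finUMagmaType) (n : nat) :
  {vspace clique_space K M n} :=
  <<[seq clique_vect K p | p : clique M n in @noncrossing M n]>>%VS.

Definition nar (n k : nat) : rat :=
  k.+1%:R^-1 * 'C(n - 2, k)%:R * 'C(n - 1, k)%:R.

(* Main.v *)
Require Import Defs.
From HB Require Import structures.
From mathcomp Require Import all_boot all_order all_algebra.
From mathcomp Require Import ring zify.

Set Implicit Arguments.
Unset Strict Implicit.
Unset Printing Implicit Defensive.

Import GRing.Theory Num.Theory.

(** The dimension is the number of noncrossing cliques, so the statement is an
    enumeration. For a set A of arcs let F(A) be the number of labelings that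
    are trivial outside A and whose solid arcs are pairwise noncrossing. Two
    properties of F suffice to compute it:
    - adding an arc e to A adds (m - 1) F(A minus the arcs crossing e), the
      number of labelings in which e is solid ([card_labelingsU1]);
    - F is multiplicative on two sets of arcs that do not cross each other
      ([card_labelingsU]).
    An arc that joins two consecutive vertices, or the two extreme vertices,
    crosses nothing; so the restriction of the noncrossing condition to
    diagonals is automatic, and each such arc contributes a factor m.

    Let W(l) be the number of noncrossing labelings of the arcs of a polygon on
    l + 1 vertices a, ..., b, the base (a, b) being left out; thus W(1) = 1, and
    the dimension is m W(n). Sorting by the last neighbour i < b of a, where
    a + 1 always counts as a neighbour, cuts the polygon along (a, i) into two
    polygons, and gives for l >= 1 the quadratic recurrence
      W(l + 1) = sum over j < l of t(j) * m W(l - j),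
      t(0) = m,  t(j) = (m - 1) W(j + 1) for j >= 1
    ([open_count_rec]). Put r = sum over j >= 1 of W(j + 1) z^j. The recurrence
    says r = z phi(r) with phi(u) = (m + (m - 1) u) (m + m u), and Lagrange
    inversion ([lagrange_inversion]) gives N [z^N] r = [u^(N-1)] phi(u)^N. As
    phi is a product of two linear factors, this coefficient is a sum over k of
    powers of m and m - 1 times 'C(N, k) * 'C(N, k + 1). For N = n - 1, dividing
    this product by N gives the Narayana number nar n k. *)

(** * Labelings avoiding a conflict relation *)

Definition labelings (M : finUMagmaType) (T : finType) (c : rel T)
    (A : {set T}) : {set {ffun T -> M}} :=
  [set f : {ffun T -> M} | [forall x, (f x != 1%g) ==> (x \in A)]
    & [forall x, forall y, (f x != 1%g) && (f y != 1%g) ==> ~~ c x y]].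

Lemma labelingsP (M : finUMagmaType) (T : finType) (c : rel T) (A : {set T})
    (f : {ffun T -> M}) :
  reflect ((forall x, f x != 1%g -> x \in A) /\
           (forall x y, f x != 1%g -> f y != 1%g -> ~~ c x y))
          (f \in labelings M c A).
Proof.
rewrite inE; apply: (iffP andP) => -[supp_f conf_f]; split.
- by move=> x; apply/implyP/(forallP supp_f).
- move=> x y fx fy; have /forallP/(_ x)/forallP/(_ y)/implyP := conf_f.
  by apply; rewrite fx.
- by apply/forallP => x; apply/implyP/supp_f.
- by apply/'forall_forallP => x y; apply/implyP => /andP[]; apply: conf_f.
Qed.

Lemma card_labelings0 (M : finUMagmaType) (T : finType) (c : rel T) :
  #|labelings M c set0| = 1%N.
Proof.
apply: (@eq_card1 _ [ffun=> 1%g]) => f; rewrite [RHS]inE.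
apply/labelingsP/eqP => [[f1 _]|->].
  by apply/ffunP => x; rewrite ffunE; apply: contraTeq isT => /f1; rewrite inE.
by split=> x; rewrite ffunE eqxx.
Qed.

(** Deletion and contraction: a labeling of [x |: A] gives x either the unit,
    and then lives on A, or one of the #|M| - 1 other labels, and then it is
    trivial on everything in conflict with x. For each of these labels, erasing
    it is a bijection onto the labelings of what is left. *)
Lemma card_labelingsU1 (M : finUMagmaType) (T : finType) (c : rel T)
    (x : T) (A : {set T}) :
    symmetric c -> irreflexive c -> x \notin A ->
  #|labelings M c (x |: A)| =
  (#|labelings M c A| + #|M|.-1 * #|labelings M c [set y in A | ~~ c x y]|)%N.
Proof.
move=> c_sym c_irr xNA.
rewrite -sum1_card (partition_big (fun f : {ffun T -> M} => f x) predT) //=.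
rewrite (bigD1 1%g) //=; congr (_ + _)%N.
  rewrite sum1dep_card; apply: eq_card => f; rewrite inE.
  apply/andP/labelingsP.
    case=> /labelingsP[supp_f conf_f] /eqP fx.
    split=> // y fy; have /setU1P[y_x|//] := supp_f y fy.
    by rewrite y_x fx eqxx in fy.
  case=> supp_f conf_f.
  split; last by apply: contraNT xNA; apply: supp_f.
  by apply/labelingsP; split=> // y /supp_f; apply: setU1r.
rewrite -(cardC1 (1%g : M)) -sum_nat_const.
apply: eq_big => [v|v vN1]; first by rewrite !inE.
rewrite sum1dep_card.
pose put (g : {ffun T -> M}) := [ffun y => if y == x then v else g y].
have put_inj : {in labelings M c [set y in A | ~~ c x y] &, injective put}.
  move=> g h /labelingsP[supp_g _] /labelingsP[supp_h _] /ffunP put_eq.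
  have unit_x k : (forall y, k y != 1%g -> y \in [set y in A | ~~ c x y]) ->
      k x = 1%g :> M.
    by move=> supp_k; apply: contraNeq xNA => /supp_k; rewrite inE => /andP[].
  apply/ffunP => y; have := put_eq y; rewrite !ffunE.
  by case: eqP => // -> _; rewrite !unit_x.
rewrite -(card_in_imset put_inj); apply: eq_card => f; rewrite inE.
apply/andP/imsetP; last first.
  case=> g /labelingsP[supp_g conf_g] ->.
  split; last by rewrite ffunE eqxx.
  apply/labelingsP; split=> [y|y z]; rewrite !ffunE.
    case: (eqVneq y x) => [-> _|_ /supp_g]; first exact: setU11.
    by rewrite inE => /andP[yA _]; apply: setU1r.
  case: (eqVneq y x) => [-> _|_ gy]; case: (eqVneq z x) => [-> _|_ gz].
  - by rewrite c_irr.
  - by have := supp_g z gz; rewrite inE => /andP[].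
  - by have := supp_g y gy; rewrite inE c_sym => /andP[].
  - exact: conf_g.
case=> /labelingsP[supp_f conf_f] /eqP fx.
exists [ffun y => if y == x then 1%g else f y]; last first.
  by apply/ffunP => y; rewrite !ffunE; case: eqP => // ->.
apply/labelingsP; split=> [y|y z]; rewrite !ffunE; last first.
  by case: (y == x); case: (z == x); rewrite ?eqxx //; apply: conf_f.
case: (eqVneq y x) => [_|yNx fy]; first by rewrite eqxx.
have /setU1P[y_x|yA] := supp_f y fy; first by rewrite y_x eqxx in yNx.
by rewrite inE yA conf_f // fx.
Qed.

(** Removing the elements of A one at a time with [card_labelingsU1] never
    touches B, so the right factor is carried along unchanged. *)
Lemma card_labelingsU (M : finUMagmaType) (T : finType) (c : rel T)
    (A B : {set T}) :
    symmetric c -> irreflexive c -> [disjoint A & B] ->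
    {in A & B, forall x y, ~~ c x y} ->
  #|labelings M c (A :|: B)| = (#|labelings M c A| * #|labelings M c B|)%N.
Proof.
move=> c_sym c_irr; have [k le_Ak] := ubnP #|A|.
elim: k A le_Ak => // k IHk A le_Ak dAB cAB.
have [->|[x xA]] := set_0Vmem A; first by rewrite set0U card_labelings0 mul1n.
rewrite -(setD1K xA); set A' := A :\ x.
have A'A : A' \subset A by exact: subD1set.
have xNA' : x \notin A' by rewrite !inE eqxx.
have xNB : x \notin B by rewrite (disjointFr dAB).
have lt_A'k : (#|A'| < k)%N by rewrite (cardsD1 x) xA in le_Ak.
have A'P (D : {set T}) : D \subset A' ->
    #|labelings M c (D :|: B)| = (#|labelings M c D| * #|labelings M c B|)%N.
  move=> DA'; have DA := subset_trans DA' A'A; apply: IHk.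
  - exact: leq_ltn_trans (subset_leq_card DA') lt_A'k.
  - exact: disjointWl DA dAB.
  - by move=> y z /(subsetP DA); apply: cAB.
rewrite -setUA card_labelingsU1 //; last by rewrite in_setU negb_or xNA'.
rewrite card_labelingsU1 // A'P // mulnDl -mulnA.
rewrite -(A'P [set y in A' | ~~ c x y]); last by apply/subsetP => y /setIdP[].
congr (_ + _ * #|labelings M c _|)%N; apply/setP => y.
rewrite in_set !in_setU in_set.
by case: (boolP (y \in B)) => yB; rewrite ?orbF // !orbT (cAB x y xA yB).
Qed.

(** * Noncrossing labelings of polygons *)

Lemma crossing_sym n : symmetric (@crossing n).
Proof. by move=> a b; rewrite /crossing orbC. Qed.

Lemma crossing_irr n : irreflexive (@crossing n).
Proof. by move=> a; rewrite /crossing ltnn. Qed.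

Lemma arc_inj n (e e' : Defs.arc n) :
  src e = src e' -> tgt e = tgt e' -> e = e'.
Proof.
by move=> ss tt; apply/val_inj/injective_projections; apply: val_inj.
Qed.

Lemma arc_ltn n (e : Defs.arc n) : src e < tgt e <= n.
Proof. by rewrite (valP e) -ltnS ltn_ord. Qed.

Lemma arc_exists n a b : a < b <= n ->
  exists e : Defs.arc n, src e = a /\ tgt e = b.
Proof.
case/andP => lt_ab le_bn; have lt_an := leq_trans lt_ab le_bn.
by exists (exist (fun x : 'I_n.+1 * 'I_n.+1 => x.1 < x.2)
   (Ordinal (ltnW lt_an : a < n.+1), Ordinal (le_bn : b < n.+1)) lt_ab).
Qed.

Definition arcs_in n a b : {set Defs.arc n} :=
  [set e | (a <= src e) && (tgt e <= b)].

(** The arcs of the polygon on the vertices a, ..., b in which the neighbours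
    of a are at most i: letting i grow adds the arcs (a, i) one by one, starting
    from the polygon on a + 1, ..., b plus one edge. *)
Definition fan n a i b : {set Defs.arc n} :=
  [set e in arcs_in n a b | (src e == a) ==> (tgt e <= i)].

Definition nc_count (M : finUMagmaType) n (A : {set Defs.arc n}) : nat :=
  #|labelings M (@crossing n) A|.

(** The bound b - 1 on the neighbours of a excludes exactly the base (a, b). *)
Definition open_count (M : finUMagmaType) n a b : nat :=
  nc_count M (fan n a b.-1 b).

(** The base crosses no arc of its polygon, so its label is free. *)
Lemma nc_count_arcs_in (M : finUMagmaType) n a b : a < b <= n ->
  nc_count M (arcs_in n a b) = (#|M| * open_count M n a b)%N.
Proof.
move=> lt_abn; have [e [src_e tgt_e]] := arc_exists lt_abn.
have M_gt0 : 0 < #|M| by apply/card_gt0P; exists 1%g.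
have -> : arcs_in n a b = e |: fan n a b.-1 b.
  apply/setP => x; rewrite !inE; have /andP[x1 x2] := arc_ltn x.
  apply/idP/idP => [/andP[ax xb]|/orP[/eqP->|/andP[]//]]; last first.
    by rewrite src_e tgt_e !leqnn.
  rewrite ax xb /=; case: (eqVneq (src x) a) => [sx|_]; last by rewrite orbT.
  case: (eqVneq (tgt x) b) => [tx|]; last by lia.
  by rewrite (@arc_inj _ x e) ?eqxx // ?sx ?tx.
rewrite /nc_count card_labelingsU1; first last.
- by rewrite !inE src_e tgt_e eqxx; lia.
- exact: crossing_irr.
- exact: crossing_sym.
rewrite (_ : [set y in _ | _] = fan n a b.-1 b).
  by rewrite -mulSn prednK.
apply/setP => x; rewrite !inE /crossing src_e tgt_e; have := arc_ltn x; lia.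
Qed.

(** Once (a, i) is solid, each other solid arc lies on one side of it: either in
    the polygon that it closes, of which it is the base, or in the polygon on
    i, ..., b, because a has no neighbour beyond i. *)
Lemma nc_count_fan_step (M : finUMagmaType) n a i b : a.+1 < i < b -> b <= n ->
  nc_count M (fan n a i b) = (nc_count M (fan n a i.-1 b) +
    #|M|.-1 * (open_count M n a i * nc_count M (arcs_in n i b)))%N.
Proof.
move=> aib bn;
have [e [src_e tgt_e]] : exists e : Defs.arc n, src e = a /\ tgt e = i.
  by apply: arc_exists; lia.
have -> : fan n a i b = e |: fan n a i.-1 b.
  apply/setP => x; rewrite !inE; have /andP[x1 x2] := arc_ltn x.
  apply/idP/idP => [/andP[/andP[ax xb] xi]|/orP[/eqP->|]]; first last.
  - lia.
  - by rewrite src_e tgt_e; lia.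
  rewrite ax xb /=; case: (eqVneq (src x) a) => [sx|_]; last by rewrite orbT.
  case: (eqVneq (tgt x) i) => [tx|]; last by lia.
  by rewrite (@arc_inj _ x e) ?eqxx // ?sx ?tx.
rewrite /nc_count card_labelingsU1; first last.
- by rewrite !inE src_e tgt_e eqxx; lia.
- exact: crossing_irr.
- exact: crossing_sym.
rewrite /open_count /nc_count -card_labelingsU; first last.
- move=> x y; rewrite !inE /crossing; have := arc_ltn x; have := arc_ltn y; lia.
- apply/pred0P => x /=; rewrite !inE; have := arc_ltn x; lia.
- exact: crossing_irr.
- exact: crossing_sym.
congr (_ + _ * #|labelings M _ _|)%N.
apply/setP => x; rewrite !inE /crossing src_e tgt_e; have := arc_ltn x; lia.
Qed.

Lemma nc_count_fan_base (M : finUMagmaType) n a b : a.+1 < b <= n ->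
  nc_count M (fan n a a.+1 b) = (#|M| * nc_count M (arcs_in n a.+1 b))%N.
Proof.
move=> abn;
have [e [src_e tgt_e]] : exists e : Defs.arc n, src e = a /\ tgt e = a.+1.
  by apply: arc_exists; lia.
have M_gt0 : 0 < #|M| by apply/card_gt0P; exists 1%g.
have -> : fan n a a.+1 b = e |: arcs_in n a.+1 b.
  apply/setP => x; rewrite !inE; have /andP[x1 x2] := arc_ltn x.
  apply/idP/idP => [/andP[/andP[ax xb] xi]|/orP[/eqP->|]]; first last.
  - lia.
  - by rewrite src_e tgt_e; lia.
  case: (eqVneq (src x) a) => [sx|]; last by lia.
  by rewrite (@arc_inj _ x e) ?eqxx // ?sx ?tgt_e; lia.
rewrite /nc_count card_labelingsU1; first last.
- by rewrite !inE src_e tgt_e; lia.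
- exact: crossing_irr.
- exact: crossing_sym.
rewrite (_ : [set y in _ | _] = arcs_in n a.+1 b).
  by rewrite -mulSn prednK.
apply/setP => x; rewrite !inE /crossing src_e tgt_e; have := arc_ltn x; lia.
Qed.

Lemma open_count1 (M : finUMagmaType) n a : open_count M n a a.+1 = 1%N.
Proof.
rewrite /open_count /nc_count (_ : fan _ _ _ _ = set0) ?card_labelings0 //.
by apply/setP => x; rewrite !inE; have := arc_ltn x; lia.
Qed.

Lemma nc_count_fan_sum (M : finUMagmaType) n a i b : a + i.+1 < b <= n ->
  nc_count M (fan n a (a + i.+1) b) =
  (\sum_(j < i.+1) (if j == 0 :> nat then #|M|
                    else #|M|.-1 * open_count M n a (a + j.+1)) *
                   (#|M| * open_count M n (a + j.+1) b))%N.
Proof.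
elim: i => [|i IHi] aib.
  rewrite big_ord_recr big_ord0 /= add0n addn1 nc_count_fan_base; last by lia.
  by rewrite nc_count_arcs_in //; lia.
rewrite nc_count_fan_step; [|lia..].
rewrite (_ : (a + i.+2).-1 = a + i.+1)%N ?IHi ?[RHS]big_ord_recr /=; [|lia..].
by rewrite nc_count_arcs_in ?mulnA //; lia.
Qed.

(** The term of index j counts the labelings in which a + j + 1 is the last
    neighbour of a; the edge (a, a + 1) has m labels, while a longer arc must be
    solid. *)
Lemma open_count_rec (M : finUMagmaType) n a l : 0 < l -> a + l.+1 <= n ->
  open_count M n a (a + l.+1) =
  (\sum_(j < l) (if j == 0 :> nat then #|M|
                 else #|M|.-1 * open_count M n a (a + j.+1)) *
                (#|M| * open_count M n (a + j.+1) (a + l.+1)))%N.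
Proof.
case: l => // l _ aln; rewrite -nc_count_fan_sum; last by lia.
by rewrite /open_count addnS.
Qed.

(** The recurrence determines the count from the number of vertices alone, so
    translating the polygon does not change it. *)
Lemma open_count_shift (M : finUMagmaType) n a l : a + l.+1 <= n ->
  open_count M n a (a + l.+1) = open_count M n 0 l.+1.
Proof.
elim/ltn_ind: l a => -[|l] IHl a aln; first by rewrite addn1 !open_count1.
rewrite open_count_rec // -[in RHS](add0n l.+2) open_count_rec; [|lia..].
apply: eq_bigr => j _; have lt_jl := ltn_ord j; rewrite !add0n.
congr (_ * (_ * _))%N; first by case: eqP => // _; rewrite IHl //; lia.
have shift c : c + l.+2 <= n ->
    open_count M n (c + j.+1) (c + l.+2) = open_count M n 0 (l - j).+1.
  move=> cln; rewrite -(IHl (l - j)%N _ (c + j.+1)%N); [|lia..].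
  by congr open_count; lia.
by rewrite shift // -(shift 0) //; lia.
Qed.

Lemma open_count0_rec (M : finUMagmaType) n l : 0 < l < n ->
  open_count M n 0 l.+1 =
  (\sum_(j < l) (if j == 0 :> nat then #|M|
                 else #|M|.-1 * open_count M n 0 j.+1) *
                (#|M| * open_count M n 0 (l - j)))%N.
Proof.
case/andP => l_gt0 lt_ln; rewrite -[l.+1]add0n open_count_rec //.
apply: eq_bigr => j _; have lt_jl := ltn_ord j; rewrite !add0n.
congr (_ * (_ * _))%N.
rewrite (_ : l.+1 = j.+1 + (l - j).-1.+1)%N; last by lia.
by rewrite open_count_shift; [congr open_count; lia | lia].
Qed.

(** * Dimension as a number of labelings *)

(** Crossing arcs are always diagonals and, for n >= 2, every labeling is a
    clique, so the noncrossing cliques are the labelings without crossing solid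
    arcs. *)
Lemma card_noncrossing (M : finUMagmaType) n : 2 <= n ->
  #|@noncrossing M n| = (#|M| * open_count M n 0 n)%N.
Proof.
move=> n_ge2; rewrite -nc_count_arcs_in; last by lia.
have -> : arcs_in n 0 n = setT.
  by apply/setP => x; rewrite !inE; have := arc_ltn x; lia.
have val_clique_inj : injective (val : clique M n -> {ffun Defs.arc n -> M}).
  exact: val_inj.
rewrite -(card_imset _ val_clique_inj); apply: eq_card => f.
apply/imsetP/labelingsP => [[p nc_p ->]|[_ conf_f]].
  split=> [x _|a b pa pb]; first by rewrite inE.
  have /forallP/(_ a)/forallP/(_ b)/implyP nc_ab := nc_p.
  apply/negP => cross; have /negP[] // : ~~ crossing a b; apply: nc_ab.
  rewrite /solid pa pb !andbT; move: cross (arc_ltn a) (arc_ltn b).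
  by rewrite /crossing /diagonal; lia.
have f_ok : (n == 1) ==> [forall a, f a == 1%g] by rewrite eqn_leq leqNgt n_ge2.
pose is_clique (p : {ffun Defs.arc n -> M}) :=
  (n == 1) ==> [forall a, p a == 1%g].
exists (exist (fun p => is_true (is_clique p)) f f_ok) => //.
apply/'forall_forallP => a b; apply/implyP => /and4P[_ _]; exact: conf_f.
Qed.

Lemma dim_NC (K : fieldType) (M : finUMagmaType) n :
  \dim (NC K M n) = #|@noncrossing M n|.
Proof.
pose X := image_tuple (@clique_vect K M n) (@noncrossing M n).
suff /eqP dimX : free X by rewrite /NC dimX size_tuple.
apply/freeP => k k0 i.
have /ffunP/(_ (enum_val i)) := k0; rewrite sum_ffunE ffunE (bigD1 i) //=.
rewrite big1 => [|j jNi]; rewrite !ffunE nth_image ffunE.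
  by rewrite eqxx addr0 => /eqP; rewrite mulf_eq0 oner_eq0 orbF => /eqP.
by rewrite (inj_eq enum_val_inj) eq_sym (negbTE jNi) scaler0.
Qed.

Local Open Scope ring_scope.

(** * Lagrange inversion *)

(** Lagrange inversion, in the form j [z^j] P(r) = [u^j] u P'(u) phi(u)^j, for
    r = z phi(r) modulo z^(N+1); allowing an arbitrary P is what makes an
    induction on j possible. Modulo constants, P = u P1, and the equation of r
    turns [z^(k+1)] P(r) into [z^k] (P1 phi)(r), to which the induction
    hypothesis applies. The two sides then agree because [u^k] u W' = k [u^k] W
    for W = P1 phi^(k+1). *)
Lemma lagrange_inversion (R : numDomainType) (phi r : {poly R}) (N : nat) :
    (forall j, (j <= N)%N -> r`_j = ('X * (phi \Po r))`_j) ->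
  forall (P : {poly R}) (j : nat), (j <= N)%N ->
    (P \Po r)`_j *+ j = ('X * P^`() * phi ^+ j)`_j.
Proof.
move=> r_fix P j; elim: j P => [|i IHi] P le_jN.
  by rewrite mulr0n -mulrA coefXM.
have [P1 [c ->]] : exists (P1 : {poly R}) (c : R), P = 'X * P1 + c%:P.
  by elim/poly_ind: P => [|p c _]; [exists 0, 0; rewrite mulr0 addr0 |
     exists p, c; rewrite mulrC].
rewrite comp_polyD comp_polyC coefD coefC addr0 comp_polyM comp_polyX.
rewrite derivD derivC addr0 -mulrA coefXM /=.
have -> : (r * (P1 \Po r))`_i.+1 = ((P1 * phi) \Po r)`_i.
  transitivity ('X * ((P1 * phi) \Po r))`_i.+1; last by rewrite coefXM.
  rewrite comp_polyM (mulrC (P1 \Po r)) mulrA !coefM.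
  apply: eq_bigr => k _; congr (_ * _).
  by apply: r_fix; rewrite (leq_trans _ le_jN) // -ltnS.
(* The induction hypothesis determines its coefficient only up to the factor i,
   so the case i = 0 is separate. *)
case: i => [|i] in IHi le_jN *.
  have r0 : r.[0] = 0 by rewrite horner_coef0 r_fix // coefXM.
  rewrite mulr1n derivM derivX mul1r expr1 -!horner_coef0.
  by rewrite horner_comp r0 !hornerE ?mul0r ?addr0.
have := IHi (P1 * phi) (ltnW le_jN).
move: i.+1 (ltn0Sn i) IHi le_jN => k k_gt0 IHi le_jN.
set c1 := (_ \Po _)`_k => c1E.
apply: (@mulIf _ k%:R); first by rewrite pnatr_eq0 -lt0n.
rewrite -[c1 *+ _]mulr_natr mulrAC !mulr_natr c1E -[RHS]mulr_natr.
pose W : {poly R} := P1 * phi ^+ k.+1.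
have W_coef : ('X * W^`())`_k = W`_k * k%:R.
  by rewrite coefXM coef_deriv mulr_natr eqn0Ngt k_gt0 prednK.
have -> : ('X * P1)^`() * phi ^+ k.+1 = W + 'X * P1^`() * phi ^+ k.+1.
  by rewrite derivM derivX mul1r mulrDl.
rewrite coefD mulrDl -W_coef mulr_natr -!coefMn -coefD; congr ((polyseq _)`_ _).
rewrite /W (derivM P1 phi) (derivM P1 (phi ^+ _)) deriv_exp /=.
have natE (p : {poly R}) q : p *+ q = p * q%:R%:P.
  by rewrite polyCMn mulr_natr.
rewrite exprS !natE -natr1 polyCD.
by move: P1^`() phi^`() (phi ^+ k) k%:R%:P => P1d phid phik kr; ring.
Qed.

(** * Narayana numbers *)

Lemma coef_linear_exp (R : comNzRingType) (a b : R) N k :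
  ((a%:P + b *: 'X) ^+ N)`_k = a ^+ (N - k) * b ^+ k *+ 'C(N, k).
Proof.
rewrite exprDn coef_sum.
have term i : (a%:P ^+ (N - i) * (b *: 'X) ^+ i *+ 'C(N, i))`_k =
    (a ^+ (N - i) * b ^+ i *+ 'C(N, i)) * (k == i)%:R.
  rewrite coefMn exprZn -polyC_exp coefCM coefZ coefXn.
  by rewrite mulrA mulrnAl.
under eq_bigr do rewrite term.
have [le_kN|lt_Nk] := leqP k N.
  rewrite (bigD1 (Ordinal (le_kN : (k < N.+1)%N))) //=.
  rewrite eqxx mulr1 big1 ?addr0 //.
  by move=> i; rewrite -val_eqE /= eq_sym => /negbTE ->; rewrite mulr0.
rewrite bin_small // big1 // => i _; rewrite (gtn_eqF _) ?mulr0 //.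
exact: leq_ltn_trans (leq_ord i) lt_Nk.
Qed.

Lemma coef_two_linear_exp (R : comNzRingType) (m x : R) N :
  (((m%:P + x *: 'X) * (m%:P + m *: 'X)) ^+ N.+1)`_N =
  \sum_(k < N.+1)
    m ^+ (N + k).+2 * x ^+ (N - k) * ('C(N.+1, k) * 'C(N.+1, k.+1))%:R.
Proof.
rewrite exprMn coefMr; apply: eq_bigr => k _; have le_kN := leq_ord k.
rewrite !coef_linear_exp -exprD subnK ?(leqW le_kN) //.
rewrite -(@bin_sub N.+1 (N - k)); last by lia.
have -> : (N.+1 - (N - k) = k.+1)%N by lia.
rewrite natrM -[m ^+ k.+1 * _ *+ _]mulr_natr -[m ^+ N.+1 *+ _]mulr_natr.
have -> : (N + k).+2 = (N.+1 + k.+1)%N by lia.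
by rewrite (exprD m N.+1 k.+1); ring.
Qed.

(** The recurrence is the coefficientwise form of r = z phi(r), where r collects
    the shifted sequence w (j + 1) without its constant term w 1: that term is
    accounted for by the constants m of the two factors of phi. *)
Lemma quadratic_rec_coef (R : numDomainType) (m x : R) (w : nat -> R) N :
    w 1%N = 1 ->
    (forall l, (0 < l <= N.+1)%N ->
       w l.+1 = \sum_(j < l) (if j == 0 :> nat then m else x * w j.+1) *
                             (m * w (l - j)%N)) ->
  w N.+2 *+ N.+1 =
  \sum_(k < N.+1)
    m ^+ (N + k).+2 * x ^+ (N - k) * ('C(N.+1, k) * 'C(N.+1, k.+1))%:R.
Proof.
move=> w1 w_rec; pose r := \poly_(j < N.+2) (if j == 0%N then 0 else w j.+1).
pose phi := (m%:P + x *: 'X) * (m%:P + m *: 'X).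
have r_coef j : (j <= N.+1)%N -> r`_j = if j == 0%N then 0 else w j.+1.
  by rewrite coef_poly ltnS => ->.
have linE a b j : (j <= N.+1)%N ->
    (a%:P + b *: r)`_j = if j == 0%N then a else b * w j.+1.
  by move=> le_jN; rewrite coefD coefC coefZ r_coef //; case: eqP => _;
    rewrite ?mulr0 ?addr0 ?add0r.
have r_fix j : (j <= N.+1)%N -> r`_j = ('X * (phi \Po r))`_j.
  move=> le_jN; rewrite r_coef // coefXM; case: j le_jN => //= l le_lN.
  rewrite w_rec // comp_polyM
          !comp_polyD !comp_polyC !comp_polyZ comp_polyX coefM.
  apply: eq_bigr => j _; have lt_jl := ltn_ord j.
  rewrite !linE; [|lia..]; congr (_ * _).
  case: eqP => [jl|_]; last by congr (_ * w _); lia.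
  by rewrite (_ : (l.+1 - j)%N = 1%N) ?w1 ?mulr1 //; lia.
have := lagrange_inversion r_fix 'X (leqnn _).
rewrite comp_polyX r_coef // derivX mulr1 coefXM => ->.
exact: coef_two_linear_exp.
Qed.

Theorem proposition4p1p7 (K : fieldType) (charK0 : [pchar K] =i pred0)
    (M : finUMagmaType) (n : nat) (n_ge2 : (2 <= n)%N) :
  let m := #|M| in
  (\dim (NC K M n))%:R =
    \sum_(0 <= k < (n - 2).+1)
      m%:R ^+ (n + k + 1) * (m%:R - 1) ^+ (n - k - 2) * nar n k :> rat.
Proof.
case: n n_ge2 => [|[|N]] // n_ge2 m.
pose W l : rat := (open_count M N.+2 0 l)%:R.
have m_gt0 : (0 < m)%N by apply/card_gt0P; exists 1%g.
have count_eq : W N.+2 *+ N.+1 = \sum_(k < N.+1)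
    m%:R ^+ (N + k).+2 * (m%:R - 1) ^+ (N - k) *
    ('C(N.+1, k) * 'C(N.+1, k.+1))%:R.
  apply: quadratic_rec_coef => [|l lN]; first by rewrite /W open_count1.
  rewrite /W open_count0_rec // natr_sum; apply: eq_bigr => j _.
  rewrite !natrM -/m; congr (_ * _); case: eqP => // _.
  by rewrite natrM -subn1 natrB.
rewrite dim_NC card_noncrossing // natrM -/m -/(W _) subn2 /= big_mkord.
apply: (@mulIf _ N.+1%:R); first by rewrite pnatr_eq0.
rewrite -mulrA mulr_natr count_eq mulr_sumr mulr_suml; apply: eq_bigr => k _.
have bin_eq : N.+1%:R * 'C(N, k)%:R = k.+1%:R * 'C(N.+1, k.+1)%:R :> rat.
  by rewrite -!natrM mul_bin_diag.
have k1_neq0 : k.+1%:R != 0 :> rat by rewrite pnatr_eq0.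
have -> : ('C(N.+1, k) * 'C(N.+1, k.+1))%:R =
    'C(N.+1, k)%:R * (k.+1%:R^-1 * (N.+1%:R * 'C(N, k)%:R)) :> rat.
  by rewrite bin_eq mulKf // natrM.
rewrite /nar subSS subSS subn0 subn1 /=.
have -> : (N.+2 + k + 1 = (N + k).+2.+1)%N by lia.
have -> : (N.+2 - k - 2 = N - k)%N by lia.
rewrite [_ ^+ (N + k).+2.+1]exprS.
move: (_ ^+ (N + k).+2) (_ ^+ (N - k)) k.+1%:R^-1 N.+1%:R => a b c d.
by move: 'C(N.+1, k)%:R 'C(N, k)%:R => e f; ring.
Qed.
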